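(* Let $n\geqslant 2$ and let $X_1,\dots,X_n$ be independent real random variables with $\mathbb{E}X_j=0$, $\mathbb{E}X_j^2=1$ and finite moments of all orders. Let $\sigma_1,\dots,\sigma_n\geqslant 0$ satisfy $\sigma_1^2+\cdots+\sigma_n^2=1$ and $\sigma_j^2<1$ for all $j$. Put $S_n=\sigma_1X_1+\cdots+\sigma_nX_n$ and, for each $k$, $S_{n;k}=\dfrac{S_n-\sigma_kX_k}{\sqrt{1-\sigma_k^2}}$. Then for all $m\geqslant 1$, \[ \mathbb{E}H_m(S_n)=\sum_{k=1}^n\frac1m\sum_{j=1}^m\binom{m}{j}\,\mathbb{E}H_{m-j}(S_{n;k})\; j\,\mathbb{E}H_j(X_k)\,(1-\sigma_k^2)^{(m-j)/2}\sigma_k^{\,j}. \]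
   Context: The Hermite polynomials $H_n$ ($n\geqslant 0$) are defined by the generating function $\sum_{n=0}^\infty \frac{H_n(x)}{n!}z^n=e^{xz-z^2/2}$; e.g. $H_0=1$, $H_1(x)=x$, $H_2(x)=x^2-1$, $H_3(x)=x^3-3x$. *)

(* Defs.v *)
From HB Require Import structures.
From mathcomp Require Import all_boot all_order all_algebra.
From mathcomp Require Import all_classical all_reals all_analysis.
Set Implicit Arguments. Unset Strict Implicit. Unset Printing Implicit Defensive.
Import Order.TTheory GRing.Theory Num.Theory.
Import numFieldNormedType.Exports.
Local Open Scope classical_set_scope.
Local Open Scope ring_scope.

(* Hermite polynomials (probabilists'), defined through the generating
   function  sum_n H_n(x) z^n / n! = e^{xz - z^2/2} = e^{xz} e^{-z^2/2}:
   the coefficient of z^n in the Cauchy product of the two exponential series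
   is  sum_{b <= n/2} x^{n-2b}/(n-2b)! * (-1/2)^b / b!,  so
   H_n(x) = n! * sum_{b <= n/2} x^{n-2b}/(n-2b)! * (-1/2)^b / b!. *)
Definition hermite {R : realType} (n : nat) (x : R) : R :=
  n`!%:R * \sum_(b < n./2.+1)
     (x ^+ (n - 2 * b) / (n - 2 * b)`!%:R * ((- 2^-1) ^+ b / b`!%:R)).

(* Real-valued expectation of f under the probability P
   (meaningful when f is P-integrable). *)
Definition Ex {d} {T : measurableType d} {R : realType}
  (P : probability T R) (f : T -> R) : R :=
  fine (\int[P]_x (f x)%:E)%E.

Definition mutually_independent {d} {T : measurableType d} {R : realType}
  (P : probability T R) (n : nat) (X : 'I_n -> T -> R) : Prop :=
  forall (J : {set 'I_n}) (B : 'I_n -> set R),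
    (forall i, measurable (B i)) ->
    P (\bigcap_(i in [set` pred_of_set J]) (X i @^-1` B i)) =
      (\prod_(i in J) P (X i @^-1` B i))%E.

(* Main.v *)
(** The coefficient sequence h(t, x) of e^{xz - tz^2/2} is characterised by the
    differential equation F' = (x - tz) F, hence h(s, x) * h(t, y) = h(s + t, x + y)
    for the Cauchy product, and, with e the Euler operator z d/dz,
    e h(s, x) * h(t, y) is xz - sz^2 times h(s + t, x + y). Splitting sum_i sigma_i x_i
    as sigma_k x_k plus the rest, and summing over k, gives the identity pointwise,
    with H_j(x_k) H_{m-j}(rest) in place of the product of expectations: only the
    uncorrelatedness of these two factors remains to be shown, and it follows from
    E prod_i f_i(X_i) = prod_i E f_i(X_i). *)
Require Import Defs.
From HB Require Import structures.
From mathcomp Require Import all_boot all_order all_algebra.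
From mathcomp Require Import all_classical all_reals all_analysis.
From mathcomp Require Import finmap measurable_realfun ring.
Import Order.TTheory GRing.Theory Num.Theory.
Import numFieldNormedType.Exports.
Local Open Scope classical_set_scope.
Local Open Scope ring_scope.
Set Implicit Arguments. Unset Strict Implicit.

(** * Formal power series as coefficient sequences, and the Hermite differential equation *)

Section power_series.
Context {R : numFieldType}.
Implicit Types (f g : nat -> R) (s t x y : R) (m : nat).

(** [shift] is multiplication of the series by z. The differential equation below is accordingly
    multiplied through by z, so that its left side is z F'. *)
Definition shift f m := if m is m'.+1 then f m' else 0.

Definition conv f g m := \sum_(j < m.+1) f j * g (m - j)%N.

Definition euler f m := m%:R * f m.

(* [f] is the coefficient sequence of a series F(z) solving F' = (x - t z) F. *)
Definition hermite_ode t x f :=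
  forall m, euler f m = x * shift f m - t * shift (shift f) m.

Lemma convC f g : conv f g = conv g f.
Proof.
apply/funext => m; rewrite /conv (reindex_inj rev_ord_inj)/=.
by apply: eq_bigr => j _; rewrite subSS subKn -1?ltnS// mulrC.
Qed.

Lemma conv_shiftl f g : conv (shift f) g = shift (conv f g).
Proof.
apply/funext => -[|m]; first by rewrite /conv big_ord1/= mul0r.
by rewrite /conv big_ord_recl/= mul0r add0r.
Qed.

(** Leibniz rule for z d/dz: the weight m splits as j + (m - j). *)
Lemma euler_conv f g m :
  euler (conv f g) m = conv (euler f) g m + conv f (euler g) m.
Proof.
rewrite /euler /conv mulr_sumr -big_split/=; apply: eq_bigr => j _.
have jm : (j <= m)%N by rewrite -ltnS.
by rewrite natrB//; ring.
Qed.

Lemma conv_euler_ode s x f g m : hermite_ode s x f ->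
  conv (euler f) g m =
    x * shift (conv f g) m - s * shift (shift (conv f g)) m.
Proof.
move=> fE; rewrite -!conv_shiftl /conv !mulr_sumr -sumrB.
by apply: eq_bigr => j _; rewrite fE; ring.
Qed.

(** Logarithmic derivatives add under multiplication, here x - s z and y - t z. *)
Lemma hermite_ode_conv s t x y f g : hermite_ode s x f -> hermite_ode t y g ->
  hermite_ode (s + t) (x + y) (conv f g).
Proof.
move=> fE gE m; rewrite euler_conv (convC f (euler g)).
by rewrite (conv_euler_ode _ _ fE) (conv_euler_ode _ _ gE) (convC g f); ring.
Qed.

(** At index m + 1 the equation expresses (m + 1) f(m + 1) through the two preceding coefficients,
    and m + 1 is invertible. *)
Lemma hermite_ode_unique t x f g : hermite_ode t x f -> hermite_ode t x g ->
  f 0%N = g 0%N -> f =1 g.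
Proof.
move=> fE gE fg0 m; elim/ltn_ind: m => -[//|m] IH.
apply: (@mulfI _ m.+1%:R); first by rewrite pnatr_eq0.
have := fE m.+1; have := gE m.+1; rewrite /euler => -> ->.
case: m IH => [|m] IH /=; first by rewrite fg0.
by rewrite !IH.
Qed.

(* H_m(x) = m! [hermite_coef 1 x m]; the variance [t] absorbs the scaling by sigma_k
   without excluding sigma_k = 0. *)
Definition hermite_coef t x m : R :=
  \sum_(b < m./2.+1)
    (x ^+ (m - 2 * b) / (m - 2 * b)`!%:R * ((- (t / 2)) ^+ b / b`!%:R)).

Lemma sum_even f m :
  \sum_(b < m./2.+1) f (2 * b)%N = \sum_(j < m.+1) (if odd j then 0 else f j).
Proof.
elim: m => [|m IH]; first by rewrite !big_ord1.
rewrite [RHS]big_ord_recr -IH/= uphalf_half.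
(* The left sum gains a term exactly when m is odd, that is, when the new index m + 1 is even. *)
case: (boolP (odd m)) => om /=; last by rewrite addr0.
rewrite big_ord_recr/=; congr (_ + f _).
by rewrite -{2}(odd_double_half m) om mul2n doubleS.
Qed.

(** The factors e^{-tz^2/2} and e^{xz}, with coefficients [w] and [u], solve the equation for the
    parameters (t, 0) and (0, x); their product then solves it for (t, x). *)
Lemma hermite_coef_ode t x : hermite_ode t x (hermite_coef t x).
Proof.
pose w j := if odd j then 0 else (- (t / 2)) ^+ j./2 / j./2`!%:R.
pose u j := x ^+ j / j`!%:R.
have -> : hermite_coef t x = conv w u.
  apply/funext => m; rewrite /hermite_coef /conv.
  pose F j := (- (t / 2)) ^+ j./2 / j./2`!%:R * u (m - j)%N.
  transitivity (\sum_(b < m./2.+1) F (2 * b)%N).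
    by apply: eq_bigr => b _; rewrite /F mul2n doubleK mulrC.
  by rewrite sum_even; apply: eq_bigr => j _; rewrite /w; case: odd; rewrite ?mul0r.
rewrite -[t in hermite_ode t _]addr0 -[x in hermite_ode _ x]add0r.
apply: hermite_ode_conv => -[|m]; rewrite /euler/=.
- by rewrite !mul0r mulr0 subr0.
- rewrite mul0r sub0r; case: m => [|m]; first by rewrite /w/= !mulr0 oppr0.
  rewrite /w/= negbK; case: (boolP (odd m)) => om; first by rewrite !mulr0 oppr0.
  rewrite factS natrM exprS -[in m.+2%:R](odd_double_half m) (negbTE om) add0n.
  rewrite -doubleS -mul2n natrM.
  have f0 : m./2`!%:R != 0 :> R by rewrite pnatr_eq0 -lt0n fact_gt0.
  have m0 : (m./2.+1)%:R != 0 :> R by rewrite pnatr_eq0.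
  by move: (_`!%:R) f0 (_.+1%:R) m0 => a a0 b b0; field; rewrite ?a0 ?b0.
- by rewrite !mul0r mulr0 subr0.
- rewrite mul0r subr0 /u factS natrM exprS.
  have f0 : m`!%:R != 0 :> R by rewrite pnatr_eq0 -lt0n fact_gt0.
  have m0 : m.+1%:R != 0 :> R by rewrite pnatr_eq0.
  by move: (_`!%:R) f0 (_.+1%:R) m0 => a a0 b b0; field; rewrite ?a0 ?b0.
Qed.

Lemma hermite_coef0 t x : hermite_coef t x 0%N = 1.
Proof. by rewrite /hermite_coef big_ord1/= !expr0 !divr1 mulr1. Qed.

Lemma hermite_coefD s t x y :
  conv (hermite_coef s x) (hermite_coef t y) = hermite_coef (s + t) (x + y).
Proof.
apply/funext; apply: (@hermite_ode_unique (s + t) (x + y)).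
- exact: hermite_ode_conv (hermite_coef_ode _ _) (hermite_coef_ode _ _).
- exact: hermite_coef_ode.
- by rewrite /conv big_ord1 !hermite_coef0 mulr1.
Qed.

(** The multiplier xz - tz^2 is additive in (t, x). Its i-th part, times the whole series, is the
    i-th summand, because [hermite_coefD] reassembles the series from index i and the rest. *)
Lemma euler_hermite_coef_sum (I : finType) (s x : I -> R) m :
  euler (hermite_coef (\sum_i s i) (\sum_i x i)) m =
  \sum_i conv (euler (hermite_coef (s i) (x i)))
    (hermite_coef (\sum_(j | j != i) s j) (\sum_(j | j != i) x j)) m.
Proof.
rewrite hermite_coef_ode !mulr_suml -sumrB; apply: eq_bigr => i _.
rewrite (conv_euler_ode _ _ (hermite_coef_ode _ _)) hermite_coefD.
by rewrite [in LHS](bigD1 i)//= [\sum_i x i](bigD1 i).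
Qed.

End power_series.

(** * The pointwise identity for Hermite polynomials of a weighted sum *)

Lemma hermite_scale {R : realType} (c x : R) m :
  c ^+ m * hermite m x = m`!%:R * hermite_coef (c ^+ 2) (c * x) m.
Proof.
rewrite /hermite /hermite_coef mulrCA; congr (_ * _); rewrite mulr_sumr.
apply: eq_bigr => b _.
have bm : (2 * b <= m)%N.
  by rewrite mul2n -geq_half_double -ltnS ltn_ord.
(* In the b-th term c^m splits as (c^2)^b c^(m-2b): the first factor scales the variance, the second
   the argument. *)
rewrite -[in c ^+ m](subnKC bm) exprD exprM -mulNr.
rewrite (_ : - c ^+ 2 / 2 = c ^+ 2 * - 2^-1); last by ring.
by rewrite !exprMn; ring.
Qed.

Lemma hermite_sum {R : realType} (n : nat) (sigma x : 'I_n -> R) (m : nat) :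
  (1 <= m)%N -> \sum_(j < n) sigma j ^+ 2 = 1 ->
  (forall j, sigma j ^+ 2 < 1) ->
  let S := \sum_(j < n) sigma j * x j in
  hermite m S = \sum_(k < n) (m%:R^-1 * \sum_(1 <= j < m.+1)
     ('C(m, j)%:R * hermite (m - j)
         ((S - sigma k * x k) / Num.sqrt (1 - sigma k ^+ 2))
       * (j%:R * hermite j (x k))
       * Num.sqrt (1 - sigma k ^+ 2) ^+ (m - j) * sigma k ^+ j)).
Proof.
move=> m1 s1 slt1 S; rewrite -mulr_sumr.
have m0 : m%:R != 0 :> R by rewrite pnatr_eq0 -lt0n.
apply: (mulfI m0); rewrite mulVKf//.
transitivity (m`!%:R * euler (hermite_coef (\sum_j sigma j ^+ 2) S) m).
  have := hermite_scale 1 S m; rewrite !expr1n !mul1r s1 => ->.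
  exact: mulrCA.
rewrite euler_hermite_coef_sum mulr_sumr; apply: eq_bigr => k _.
(* The Euler factor j kills the term j = 0, so the sum starts at 1. *)
rewrite /conv big_ord_recl /euler/= !mul0r add0r.
rewrite big_add1/= big_mkord mulr_sumr; apply: eq_bigr => j _.
rewrite /bump/= add1n.
have jm : (j.+1 <= m)%N by [].
set r := Num.sqrt _.
have r0 : r != 0 by rewrite gt_eqF// sqrtr_gt0 subr_gt0.
have rE : \sum_(j0 < n | j0 != k) sigma j0 ^+ 2 = r ^+ 2.
  rewrite sqr_sqrtr; last by rewrite subr_ge0 ltW.
  by rewrite -s1 [in RHS](bigD1 k)//= addrAC subrr add0r.
have SE : \sum_(j0 < n | j0 != k) sigma j0 * x j0 = r * ((S - sigma k * x k) / r).
  by rewrite mulrC divfK// /S [in RHS](bigD1 k)//= addrAC subrr add0r.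
(* Writing m! = C(m, j) j! (m - j)! gives each of the two coefficient sequences the factorial that
   turns it into a Hermite polynomial. *)
rewrite rE SE -(bin_fact jm) 2!natrM.
transitivity ('C(m, j.+1)%:R * j.+1%:R * (sigma k ^+ j.+1 * hermite j.+1 (x k))
   * (r ^+ (m - j.+1) * hermite (m - j.+1) ((S - sigma k * x k) / r))).
  by rewrite !hermite_scale; ring.
by ring.
Qed.

(** * Extending a factorization of integrals from indicators to nonnegative functions *)

Section integral_factor.
Context d (T : measurableType d) (R : realType).
Variables (mu : {measure set T -> \bar R}) (phi : T -> R).
Hypothesis mphi : measurable_fun setT phi.
Import HBNNSimple.

(** A simple function is the combination of the indicators of its level sets; all terms are
    nonnegative, so the integral is additive. *)
Let integral_nnsfunM (h : {nnsfun R >-> R}) (Z : T -> R) :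
  measurable_fun setT Z -> (forall x, 0 <= Z x) ->
  let s := finmap.enum_fset (fset_set (range h)) in
  (\int[mu]_x (h (phi x) * Z x)%:E =
   \sum_(i < size s) (s`_i)%:E *
     \int[mu]_x (\1_(h @^-1` [set s`_i]) (phi x) * Z x)%:E)%E.
Proof.
move=> mZ Z0 s.
have s0 (i : 'I_(size s)) : 0 <= s`_i.
  have : s`_i \in fset_set (range h) by exact: mem_nth.
  by rewrite in_fset_set// => /set_mem[y _ <-].
have mA (i : 'I_(size s)) : measurable_fun setT
    (fun x => \1_(h @^-1` [set s`_i]) (phi x) * Z x).
  apply: measurable_funM => //; exact: measurableT_comp.
transitivity (\int[mu]_x (\sum_(i < size s) (s`_i)%:E *
    (\1_(h @^-1` [set s`_i]) (phi x) * Z x)%:E))%E.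
  apply: eq_integral => x _; rewrite fimfunEord -/s mulr_suml -sumEFin.
  by apply: eq_bigr => i _; rewrite -EFinM mulrA.
rewrite ge0_integral_sum//; last 2 first.
- move=> i; apply/measurable_EFinP; apply: measurable_funM => //; exact: mA.
- by move=> i x _; rewrite -EFinM lee_fin !mulr_ge0.
apply: eq_bigr => i _; rewrite ge0_integralZl_EFin//.
- by move=> x _; rewrite lee_fin mulr_ge0.
- exact/measurable_EFinP/mA.
Qed.

Lemma ge0_integral_factor (Z : T -> R) :
  measurable_fun setT Z -> (forall x, 0 <= Z x) ->
  mu.-integrable setT (EFin \o Z) ->
  (forall B, measurable B ->
    \int[mu]_x (\1_B (phi x) * Z x)%:E = mu (phi @^-1` B) * \int[mu]_x (Z x)%:E)%E ->
  forall f : R -> R, measurable_fun setT f -> (forall y, 0 <= f y) ->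
  (\int[mu]_x (f (phi x) * Z x)%:E =
   \int[mu]_x (f (phi x))%:E * \int[mu]_x (Z x)%:E)%E.
Proof.
move=> mZ Z0 iZ H f mf f0.
have mfE : measurable_fun setT (EFin \o f) by exact/measurable_EFinP.
pose h := nnsfun_approx measurableT mfE.
have hf y : EFin \o h^~ y @ \oo --> (f y)%:E.
  by apply: cvg_nnsfun_approx => // z _; rewrite lee_fin.
have iZfin : (\int[mu]_x (Z x)%:E)%E \is a fin_num by exact: integrable_fin_num.
(* Monotone convergence along the simple approximations of [f], used with [Y] equal to [Z] and to
   1. *)
have mono (Y : T -> R) : measurable_fun setT Y -> (forall x, 0 <= Y x) ->
    (\int[mu]_x (h n (phi x) * Y x)%:E)%E @[n --> \oo] -->
    (\int[mu]_x (f (phi x) * Y x)%:E)%E.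
  move=> mY Y0.
  rewrite (_ : (\int[mu]_x (f (phi x) * Y x)%:E)%E =
    (\int[mu]_x (limn (fun n => (h n (phi x) * Y x)%:E)))%E); last first.
    apply: eq_integral => x _; apply/esym/cvg_lim => //.
    under eq_fun do rewrite EFinM.
    by rewrite EFinM; apply: cvgeZr => //; exact: hf.
  apply: cvg_monotone_convergence => //.
  - move=> n; apply/measurable_EFinP/measurable_funM => //.
    by apply: measurableT_comp.
  - by move=> n x _; rewrite lee_fin mulr_ge0.
  - move=> x _ m n mn; rewrite lee_fin ler_wpM2r//.
    by have /lefP := nd_nnsfun_approx measurableT mfE mn; exact.
have cZ := mono Z mZ Z0.
have c1 := mono (cst 1) (measurable_cst _) (fun=> ler01).
(* The approximations of both sides agree term by term; multiplication by the integral of [Z]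
   preserves the limit because that integral is finite. *)
apply: (cvg_unique _ cZ) => //.
have -> : (\int[mu]_x (f (phi x))%:E)%E = (\int[mu]_x (f (phi x) * cst 1 x)%:E)%E.
  by apply: eq_integral => x _; rewrite /= mulr1.
rewrite (_ : (fun n => _) = (fun n => (\int[mu]_x (h n (phi x) * cst 1 x)%:E) *
   \int[mu]_x (Z x)%:E)%E); first exact: cvgeZr.
apply/funext => n.
rewrite !integral_nnsfunM// ge0_sume_distrl; last first.
  move=> i _; apply: mule_ge0; last first.
    by apply: integral_ge0 => x _; rewrite lee_fin mulr_ge0.
  have : (enum_fset (fset_set (range (h n))))`_i \in fset_set (range (h n)).
    exact: mem_nth.
  by rewrite in_fset_set// => /set_mem[y _ <-]; rewrite lee_fin.
apply: eq_bigr => i _; rewrite H; last exact: measurable_funPTI.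
rewrite muleA; congr (_ * _ * _)%E.
transitivity (\int[mu]_x (\1_(phi @^-1` (h n @^-1`
    [set (finmap.enum_fset (fset_set (range (h n))))`_i])) x)%:E)%E.
  rewrite integral_indic ?setIT// -[X in measurable X]setTI; exact: mphi.
by apply: eq_integral => x _; rewrite /= mulr1.
Qed.
End integral_factor.

(** * Expectation of a product of functions of independent variables *)

Section independent_product.
Context d (T : measurableType d) (R : realType) (P : probability T R).
Variables (n : nat) (X : 'I_n -> T -> R).
Hypothesis mX : forall i, measurable_fun setT (X i).
Hypothesis indepX : mutually_independent P X.

Let measurable_prod_comp (p : pred 'I_n) (f : 'I_n -> R -> R) :
  (forall i, measurable_fun setT (f i)) ->
  measurable_fun setT (fun x => \prod_(i < n | p i) f i (X i x)).
Proof.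
move=> mf; under eq_fun do rewrite big_mkcond.
elim: (index_enum _) => [|i s IH].
  by under eq_fun do rewrite big_nil; exact: measurable_cst.
under eq_fun do rewrite big_cons; apply: measurable_funM => //.
by case: (p i) => //; apply: measurableT_comp.
Qed.

Let integral_prod_indic (B : 'I_n -> set R) :
  (forall i, measurable (B i)) ->
  (\int[P]_x (\prod_i \1_(B i) (X i x))%:E =
   \prod_i \int[P]_x (\1_(B i) (X i x))%:E)%E.
Proof.
move=> mB.
have mXB i : measurable (X i @^-1` B i).
  by rewrite -[X in measurable X]setTI; exact: mX.
(* The product of the indicators is the indicator of [A], whose probability is given by independence
   for the full index set. *)
pose A := \bigcap_(i in [set` pred_of_set [set: 'I_n]%SET]) (X i @^-1` B i).
transitivity (\int[P]_x (\1_A x)%:E)%E.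
  apply: eq_integral => x _; congr EFin.
  rewrite indicE; have [|nA] := boolP (x \in A).
    move/set_mem => Ax; rewrite big1// => i _.
    by rewrite indicE mem_set//; apply: Ax => /=; rewrite inE.
  apply/eqP/prodf_eq0.
  move: nA; rewrite notin_setE => nA.
  apply: contrapT => H; apply: nA => i _ /=.
  apply: contrapT => nB; apply: H; exists i => //.
  by rewrite indicE memNset.
rewrite integral_indic//; last by apply: fin_bigcap_measurable.
rewrite setIT.
transitivity (\prod_(i in [set: 'I_n]%SET) P (X i @^-1` B i))%E.
  exact: indepX.
apply: eq_big => [i|i _]; first by rewrite inE.
rewrite -[LHS]/(P (X i @^-1` B i)).
by have := integral_indic P measurableT (mXB i); rewrite setIT => <-.
Qed.

(* [s] lists the indices at which the indicators have been replaced by arbitrary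
   nonnegative functions. *)
Let ge0_integral_prod_in (s : seq 'I_n) (f : 'I_n -> R -> R) :
  (forall i, measurable_fun setT (f i)) -> (forall i y, 0 <= f i y) ->
  (forall i, P.-integrable setT (fun x => (f i (X i x))%:E)) ->
  (forall i, i \notin s -> exists2 B, measurable B & f i = \1_B) ->
  (\int[P]_x (\prod_i f i (X i x))%:E = \prod_i \int[P]_x (f i (X i x))%:E)%E.
Proof.
elim: s f => [|k s IH] f mf f0 intf fB.
  have {}fB i := cid2 (fB i isT).
  have fE i : f i = \1_(projT1 (fB i)) by case: (fB i).
  under eq_integral do under eq_bigr do rewrite fE.
  under [RHS]eq_bigr do rewrite fE.
  by rewrite integral_prod_indic// => i; case: (fB i).
pose g (B : set R) i := if i == k then \1_B else f i.
pose Z x := \prod_(i < n | i != k) f i (X i x).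
pose cZ := (\prod_(i < n | i != k) \int[P]_x (f i (X i x))%:E)%E.
have mZ : measurable_fun setT Z by exact: measurable_prod_comp.
have Z0 x : 0 <= Z x by apply: prodr_ge0.
(* With an indicator in place of [f k], the index k may leave the list and the induction hypothesis
   applies. *)
have ZB B : measurable B ->
    (\int[P]_x (\1_B (X k x) * Z x)%:E = P (X k @^-1` B) * cZ)%E.
  move=> mB; have mXB : measurable (X k @^-1` B).
    by rewrite -[X in measurable X]setTI; exact: mX.
  have gE x : \prod_i g B i (X i x) = \1_B (X k x) * Z x.
    rewrite (bigD1 k)//= /g eqxx; congr (_ * _).
    by apply: eq_bigr => i /negPf ->.
  transitivity (\int[P]_x (\prod_i g B i (X i x))%:E)%E.
    by apply: eq_integral => x _; rewrite gE.
  rewrite IH.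
  - rewrite (bigD1 k)//= {1}/g eqxx; congr (_ * _)%E; last first.
      by apply: eq_bigr => i /negPf ik; rewrite /g ik.
    by have := integral_indic P measurableT mXB; rewrite setIT => <-.
  - by move=> i; rewrite /g; case: eqP => // _; exact: measurable_indic.
  - by move=> i y; rewrite /g; case: eqP => // _.
  - move=> i; rewrite /g; case: eqP => [->|//].
    exact: integrable_indic.
  - move=> i si; rewrite /g; case: eqP => [_|/eqP ik]; first by exists B.
    by apply: fB; rewrite inE negb_or ik.
(* Taking [B] to be the whole line in [ZB] isolates the integral of [Z]. *)
have iZ : (\int[P]_x (Z x)%:E = cZ)%E.
  have := ZB _ measurableT; rewrite preimage_setT probability_setT mul1e => <-.
  by apply: eq_integral => x _; rewrite indicT mul1r.
have cZfin : cZ \is a fin_num.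
  apply: (@big_ind _ (fun z : \bar R => z \is a fin_num)) => // [x y|i _];
    [exact: fin_numM|exact: integrable_fin_num].
have intZ : P.-integrable setT (EFin \o Z).
  apply/integrableP; split; first exact/measurable_EFinP.
  under eq_integral => x _ do rewrite gee0_abs ?lee_fin//.
  by rewrite iZ ltey_eq cZfin.
rewrite (bigD1 k)//= -/cZ -iZ -(ge0_integral_factor (mX k))//; last first.
  by move=> B mB; rewrite ZB// iZ.
by apply: eq_integral => x _; rewrite (bigD1 k).
Qed.

Let ge0_integral_prod (f : 'I_n -> R -> R) :
  (forall i, measurable_fun setT (f i)) -> (forall i y, 0 <= f i y) ->
  (forall i, P.-integrable setT (fun x => (f i (X i x))%:E)) ->
  (\int[P]_x (\prod_i f i (X i x))%:E = \prod_i \int[P]_x (f i (X i x))%:E)%E.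
Proof.
move=> mf f0 intf; apply: (@ge0_integral_prod_in (enum 'I_n)) => // i.
by rewrite mem_enum.
Qed.

(* [s] lists the indices at which [f] may change sign; for such an index the
   nonnegative case applies to the two terms of f = (|f| + f) - |f|. *)
Let Ex_prod_in (s : seq 'I_n) (f : 'I_n -> R -> R) :
  (forall i, measurable_fun setT (f i)) ->
  (forall i, P.-integrable setT (fun x => (f i (X i x))%:E)) ->
  (forall i, i \notin s -> forall y, 0 <= f i y) ->
  P.-integrable setT (EFin \o (fun x => \prod_i f i (X i x))) /\
  Ex P (fun x => \prod_i f i (X i x)) = \prod_i Ex P (fun x => f i (X i x)).
Proof.
elim: s f => [|k s IH] f mf intf f0.
  have {}f0 i y : 0 <= f i y by exact: f0.
  have E := ge0_integral_prod mf f0 intf.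
  have fin : (\prod_i \int[P]_x (f i (X i x))%:E)%E \is a fin_num.
    apply: (@big_ind _ (fun z : \bar R => z \is a fin_num)) => // [x y|i _];
    [exact: fin_numM|exact: integrable_fin_num].
  split.
    apply/integrableP; split; first exact/measurable_EFinP/measurable_prod_comp.
    under eq_integral => x _ do rewrite gee0_abs ?lee_fin ?prodr_ge0//.
    by rewrite E ltey_eq fin.
  rewrite /Ex E.
  apply: EFin_inj; rewrite fineK// -prodEFin; apply: eq_bigr => i _.
  by rewrite fineK//; exact: integrable_fin_num.
pose g (h : R -> R) i := if i == k then h else f i.
pose Z x := \prod_(i < n | i != k) f i (X i x).
pose cZ := \prod_(i < n | i != k) Ex P (fun x => f i (X i x)).
have gE (h : R -> R) : measurable_fun setT h -> (forall y, 0 <= h y) ->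
    P.-integrable setT (fun x => (h (X k x))%:E) ->
    P.-integrable setT (EFin \o (fun x => h (X k x) * Z x)) /\
    Ex P (fun x => h (X k x) * Z x) = Ex P (fun x => h (X k x)) * cZ.
  move=> mh h0 inth; have := IH (g h).
  have -> : (fun x => \prod_i g h i (X i x)) = (fun x => h (X k x) * Z x).
    apply/funext => x; rewrite (bigD1 k)//= /g eqxx; congr (_ * _).
    by apply: eq_bigr => i /negPf ->.
  have -> : \prod_i Ex P (fun x => g h i (X i x)) = Ex P (fun x => h (X k x)) * cZ.
    rewrite (bigD1 k)//= {1}/g eqxx; congr (_ * _).
    by apply: eq_bigr => i /negPf ik; rewrite /g ik.
  apply.
  - by move=> i; rewrite /g; case: eqP.
  - by move=> i; rewrite /g; case: eqP => // ->.
  - move=> i si; rewrite /g; case: eqP => // /eqP ik.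
    by apply: f0; rewrite inE negb_or ik.
pose q y := `|f k y|; pose p y := `|f k y| + f k y.
have mq : measurable_fun setT q by exact: measurableT_comp.
have iq : P.-integrable setT (fun x => (q (X k x))%:E).
  exact: (integrable_norm (intf k)).
have mp : measurable_fun setT p by exact: measurable_funD.
have ip : P.-integrable setT (fun x => (p (X k x))%:E).
  exact: (integrableD measurableT iq (intf k)).
have p0 y : 0 <= p y by rewrite /p addrC -lerBlDr sub0r lerNnormlW.
have [ipZ EpZ] := gE p mp p0 ip.
have [iqZ EqZ] := gE q mq (fun y => normr_ge0 _) iq.
have pqE y : f k y = p y - q y by rewrite /p /q addrAC subrr add0r.
have -> : (fun x => \prod_i f i (X i x)) =
          (fun x => p (X k x) * Z x - q (X k x) * Z x).
  by apply/funext => x; rewrite (bigD1 k)//= pqE mulrBl.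
split; first exact: (integrableB measurableT ipZ iqZ).
rewrite (bigD1 k)//= -/cZ.
transitivity (Ex P (fun x => p (X k x) * Z x) - Ex P (fun x => q (X k x) * Z x)).
  exact: RintegralB.
rewrite EpZ EqZ -mulrBl; congr (_ * _).
transitivity (Ex P (fun x => p (X k x) - q (X k x))).
  by apply/esym; exact: RintegralB.
by congr Ex; apply/funext => x; rewrite pqE.
Qed.

Lemma Ex_prod (f : 'I_n -> R -> R) :
  (forall i, measurable_fun setT (f i)) ->
  (forall i, P.-integrable setT (fun x => (f i (X i x))%:E)) ->
  P.-integrable setT (EFin \o (fun x => \prod_i f i (X i x))) /\
  Ex P (fun x => \prod_i f i (X i x)) = \prod_i Ex P (fun x => f i (X i x)).
Proof.
by move=> mf intf; apply: (@Ex_prod_in (enum 'I_n)) => // i; rewrite mem_enum.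
Qed.

End independent_product.

(** * Uncorrelatedness, from monomials to Hermite polynomials *)

Section uncorrelated.
Context d (T : measurableType d) (R : realType) (P : probability T R).
Implicit Types Y Z : T -> R.

Lemma Ex_sum (I : Type) (s : seq I) (p : pred I) (c : I -> R) (Z : I -> T -> R) :
  (forall i, p i -> P.-integrable setT (EFin \o Z i)) ->
  P.-integrable setT (EFin \o (fun x => \sum_(i <- s | p i) c i * Z i x)) /\
  Ex P (fun x => \sum_(i <- s | p i) c i * Z i x) =
  \sum_(i <- s | p i) c i * Ex P (Z i).
Proof.
move=> iZ; elim: s => [|i s [IHi IHE]].
  have -> : (fun x => \sum_(i <- [::] | p i) c i * Z i x) = cst 0.
    by apply/funext => x; rewrite big_nil.
  by split; [exact: integrable0|rewrite big_nil /Ex integral0].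
rewrite big_cons.
have -> : (fun x => \sum_(i <- i :: s | p i) c i * Z i x) =
    (fun x => if p i then c i * Z i x + \sum_(i <- s | p i) c i * Z i x
              else \sum_(i <- s | p i) c i * Z i x).
  by apply/funext => x; rewrite big_cons.
case: ifP => // pi.
have icZ : P.-integrable setT (EFin \o (fun x => c i * Z i x)).
  exact: (integrableZl measurableT (c i) (iZ i pi)).
split; first exact: (integrableD measurableT icZ IHi).
transitivity (Ex P (fun x => c i * Z i x) +
    Ex P (fun x => \sum_(i <- s | p i) c i * Z i x)).
  exact: RintegralD.
by rewrite IHE; congr (_ + _); exact: RintegralZl (iZ i pi).
Qed.

(** Integrability is carried along with the product formula, which makes the relation stable under
    linear combinations of [Z]. *)
Definition uncorrelated Y Z :=
  [/\ P.-integrable setT (EFin \o Y), P.-integrable setT (EFin \o Z),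
      P.-integrable setT (EFin \o (fun x => Y x * Z x)) &
      Ex P (fun x => Y x * Z x) = Ex P Y * Ex P Z].

Lemma uncorrelatedC Y Z : uncorrelated Y Z -> uncorrelated Z Y.
Proof.
move=> [iY iZ iYZ E].
have YZ : (fun x => Z x * Y x) = (fun x => Y x * Z x).
  by apply/funext => x; rewrite mulrC.
by split; rewrite ?YZ// mulrC.
Qed.

Lemma uncorrelated_sum (I : Type) (s : seq I) (p : pred I) (c : I -> R) Y
    (Z : I -> T -> R) :
  P.-integrable setT (EFin \o Y) -> (forall i, p i -> uncorrelated Y (Z i)) ->
  uncorrelated Y (fun x => \sum_(i <- s | p i) c i * Z i x).
Proof.
move=> iY H.
have [i1 E1] := @Ex_sum I s p c Z (fun i pi => let: And4 _ h _ _ := H i pi in h).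
have [i2 E2] := @Ex_sum I s p c (fun i x => Y x * Z i x)
  (fun i pi => let: And4 _ _ h _ := H i pi in h).
have YE : (fun x => Y x * \sum_(i <- s | p i) c i * Z i x) =
    (fun x => \sum_(i <- s | p i) c i * (Y x * Z i x)).
  by apply/funext => x; rewrite mulr_sumr; apply: eq_bigr => i _; rewrite mulrCA.
split; rewrite ?YE// E1 E2 mulr_sumr; apply: eq_bigr => i pi.
by have [_ _ _ ->] := H i pi; rewrite mulrCA.
Qed.

Lemma uncorrelated_hermite m a Y Z :
  (forall e, uncorrelated Y (fun x => Z x ^+ e)) ->
  uncorrelated Y (fun x => hermite m (Z x / a)).
Proof.
move=> H.
have -> : (fun x => hermite m (Z x / a)) = (fun x => \sum_(b < m./2.+1)
    (m`!%:R * (a^-1 ^+ (m - 2 * b) / (m - 2 * b)`!%:R *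
      ((- 2^-1) ^+ b / b`!%:R))) * Z x ^+ (m - 2 * b)).
  apply/funext => x; rewrite /hermite mulr_sumr; apply: eq_bigr => b _.
  by rewrite exprMn; ring.
by apply: uncorrelated_sum => //; case: (H 0%N).
Qed.

Section independent_hermite.
Variables (n : nat) (X : 'I_n -> T -> R).
Hypothesis mX : forall i, measurable_fun setT (X i).
Hypothesis indepX : mutually_independent P X.
Hypothesis momX : forall i e, P.-integrable setT (fun x => (X i x ^+ e)%:E).

(** Multiplication by X_k^j only changes the exponent at k from 0 to j, so [Ex_prod] evaluates both
    monomials and they differ in the factor at k. *)
Lemma uncorrelated_monomial (k : 'I_n) j (e : 'I_n -> nat) : e k = 0%N ->
  uncorrelated (fun x => X k x ^+ j) (fun x => \prod_i X i x ^+ e i).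
Proof.
move=> ek; pose e' i := if i == k then j else e i.
have mX_ (f : 'I_n -> nat) i : measurable_fun setT (fun y : R => y ^+ f i).
  exact: measurable_funX.
have [ie Ee] := @Ex_prod _ _ _ P _ _ mX indepX
  (fun i y => y ^+ e i) (mX_ e) (fun i => momX i _).
have [ie' Ee'] := @Ex_prod _ _ _ P _ _ mX indepX
  (fun i y => y ^+ e' i) (mX_ e') (fun i => momX i _).
have e'E x : \prod_i X i x ^+ e' i = X k x ^+ j * \prod_i X i x ^+ e i.
  rewrite !(bigD1 k (P := predT))//= /e' eqxx ek expr0 mul1r; congr (_ * _).
  by apply: eq_bigr => i /negPf ->.
have {}e'E : (fun x => X k x ^+ j * \prod_i X i x ^+ e i) =
    (fun x => \prod_i X i x ^+ e' i) by apply/funext => x; rewrite e'E.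
split; rewrite ?e'E//; first exact: momX.
rewrite Ee' Ee !(bigD1 k (P := predT))//= {1}/e' eqxx ek.
have -> : Ex P (fun x => X k x ^+ 0) = 1.
  by rewrite /Ex; under eq_integral do rewrite expr0;
    rewrite integral_cst// -[X in (_ * X)%E]/(P setT) probability_setT mule1.
rewrite mul1r; congr (_ * _).
by apply: eq_bigr => i /negPf ik; rewrite /e' ik.
Qed.

Lemma uncorrelated_linear_power (k : 'I_n) (c : 'I_n -> R) j a :
  uncorrelated (fun x => X k x ^+ j)
    (fun x => (\sum_(i | i != k) c i * X i x) ^+ a).
Proof.
set W := fun x => \sum_(i | i != k) c i * X i x.
(* The monomial prefix absorbs the variables split off as the power is expanded one factor at a
   time; they have index i distinct from k, so the exponent at k stays 0. *)
suff H (e : 'I_n -> nat) : e k = 0%N -> uncorrelated (fun x => X k x ^+ j)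
    (fun x => (\prod_i X i x ^+ e i) * W x ^+ a).
  have := H (fun=> 0%N) erefl; congr uncorrelated; apply/funext => x.
  by rewrite big1 ?mul1r.
elim: a e => [|a IH] e ek.
  have := uncorrelated_monomial j ek; congr uncorrelated; apply/funext => x.
  by rewrite mulr1.
have -> : (fun x => (\prod_i X i x ^+ e i) * W x ^+ a.+1) =
    (fun x => \sum_(i | i != k)
      c i * ((\prod_l X l x ^+ (e l + (l == i))) * W x ^+ a)).
  apply/funext => x; rewrite exprSr mulrA {2}/W mulr_sumr; apply: eq_bigr => i _.
  have -> : \prod_l X l x ^+ (e l + (l == i)) = X i x * \prod_l X l x ^+ e l.
    rewrite !(bigD1 i (P := predT))//= eqxx exprD expr1 mulrA [X i x * _]mulrC.
    congr (_ * _); apply: eq_bigr => l /negPf ->.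
    by rewrite addn0.
  by ring.
apply: uncorrelated_sum => [|i ik]; first exact: momX.
by apply: IH; rewrite ek eq_sym (negPf ik).
Qed.

Lemma uncorrelated_hermite_sum (k : 'I_n) (c : 'I_n -> R) j l r :
  uncorrelated (fun x => hermite j (X k x))
    (fun x => hermite l ((\sum_(i | i != k) c i * X i x) / r)).
Proof.
apply: uncorrelated_hermite => a; apply: uncorrelatedC.
(* The other factor is expanded by symmetry, with scale 1. *)
have := @uncorrelated_hermite j 1
  (fun x => (\sum_(i | i != k) c i * X i x) ^+ a) (X k).
have -> : (fun x => hermite j (X k x / 1)) = (fun x => hermite j (X k x)).
  by apply/funext => x; rewrite divr1.
by apply=> e; apply: uncorrelatedC; exact: uncorrelated_linear_power.
Qed.

End independent_hermite.
End uncorrelated.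

(** * From the pointwise identity to expectations *)

Theorem theorem4 (d : measure_display) (T : measurableType d) (R : realType)
  (P : probability T R) (n : nat) (X : 'I_n -> {RV P >-> R})
  (sigma : 'I_n -> R) (m : nat) :
  (2 <= n)%N ->
  mutually_independent P (fun j => (X j : T -> R)) ->
  (forall j k, P.-integrable setT (fun x => ((X j x) ^+ k)%:E)) ->
  (forall j, (\int[P]_x (X j x)%:E = 0)%E) ->
  (forall j, (\int[P]_x ((X j x) ^+ 2)%:E = 1)%E) ->
  (forall j, 0 <= sigma j) ->
  \sum_(j < n) sigma j ^+ 2 = 1 ->
  (forall j, sigma j ^+ 2 < 1) ->
  (1 <= m)%N ->
  let S := fun x => \sum_(j < n) sigma j * X j x in
  let Sk := fun (k : 'I_n) x =>
    (S x - sigma k * X k x) / Num.sqrt (1 - sigma k ^+ 2) in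
  Ex P (fun x => hermite m (S x)) =
    \sum_(k < n) (m%:R^-1 * \sum_(1 <= j < m.+1)
       ('C(m, j)%:R * Ex P (fun x => hermite (m - j) (Sk k x))
         * (j%:R * Ex P (fun x => hermite j (X k x)))
         * Num.sqrt (1 - sigma k ^+ 2) ^+ (m - j) * sigma k ^+ j)).
Proof.
move=> _ indepX momX _ _ _ s1 slt1 m1 S Sk.
have mX k : measurable_fun setT (X k) by [].
have unc k j l : uncorrelated P (fun x => hermite j (X k x))
    (fun x => hermite l (Sk k x)).
  (* Cancelling the k-th term shows that [Sk k] involves only the variables of index other than
     k. *)
  have -> : (fun x => hermite l (Sk k x)) = (fun x => hermite l
      ((\sum_(i | i != k) sigma i * X i x) / Num.sqrt (1 - sigma k ^+ 2))).
    apply/funext => x; congr (hermite l (_ / _)).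
    by rewrite /S (bigD1 k)//= addrAC subrr add0r.
  exact: (@uncorrelated_hermite_sum _ _ _ P n (fun i => X i : T -> R) mX indepX).
pose c k j := 'C(m, j)%:R * j%:R * Num.sqrt (1 - sigma k ^+ 2) ^+ (m - j)
  * sigma k ^+ j.
pose G k x := \sum_(1 <= j < m.+1)
  c k j * (hermite j (X k x) * hermite (m - j) (Sk k x)).
have iG k := @Ex_sum _ _ _ P _ (index_iota 1 m.+1) predT (c k)
  (fun j x => hermite j (X k x) * hermite (m - j) (Sk k x))
  (fun j _ => let: And4 _ _ h _ := unc k j (m - j)%N in h).
(* The pointwise identity makes the left side a linear combination of products whose expectations
   factor by [unc]. *)
have -> : (fun x => hermite m (S x)) = (fun x => \sum_k m%:R^-1 * G k x).
  apply/funext => x; rewrite /S (hermite_sum _ m1 s1 slt1).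
  apply: eq_bigr => k _; congr (_ * _); apply: eq_bigr => j _.
  by rewrite /c; ring.
have [_ ->] := @Ex_sum _ _ _ P _ (index_enum 'I_n) predT (fun=> m%:R^-1) G
  (fun k _ => (iG k).1).
apply: eq_bigr => k _; congr (_ * _); rewrite (iG k).2.
apply: eq_bigr => j _; have [_ _ _ ->] := unc k j (m - j)%N.
by rewrite /c; ring.
Qed.
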